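(* In the team-design model described in the context, fix an orthonormal basis $(\phi_i)_{i=1}^\infty$ and let $\Lambda:[0,\varepsilon]\to\ell^1_+$, $\Lambda(t)=(\lambda_1(t),\lambda_2(t),\dots)$, be continuously differentiable into $\ell^1$, nonzero and weakly decreasing in $i$ for every $t$, with $C_t(x,x')=\sum_i\lambda_i(t)\phi_i(x)\phi_i(x')$ a continuous covariance kernel satisfying the feasibility assumptions of the model for every $t$. Suppose that $\sum_{i=1}^\infty\lambda_i(t)$ is constant in $t$ and that there exists $j^*\ge1$ such that $\lambda_i'(0)<0$ for all $i\le j^*$ and $\lambda_i'(0)>0$ for all $i>j^*$. Then, for every attention level $\rho>0$ at which there is a uniquely optimal interior team size $k^*(t)$ for all $t\in[0,\varepsilon]$, team size is weakly increasing in $t$ at $t=0$ (i.e. the one-sided derivative of $k^*$ at $t=0$, whenever it exists, is $\ge 0$).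
   Context: Model. For a mean-zero Gaussian process $W_0$ on $[0,1]$ with symmetric, continuous, positive definite covariance kernel $C$ with finite integrated variance (these are the feasibility assumptions), let $\lambda_1\ge\lambda_2\ge\dots$ be the eigenvalues of the covariance operator; it is assumed throughout that infinitely many are strictly positive. The function $f:[1,\infty)\to\mathbb R$ is strictly increasing and smooth, $f(1)=1$, $\lim_{k\to\infty}f(k)=\infty$. Given attention capacity $\rho>0$, $\mu^*>0$ is the unique number with $\frac12\sum_i\max\{0,\log(\lambda_i/\mu^* )\}=\rho$, and $n=\#\{i:\lambda_i>\mu^*\}$. Under the optimal signal of mutual information at most $\rho$ about the team-state process $W_1(u)=W_0(ku)/2$ on $[0,1/k]$, the organization's total (coordination plus adaptation) loss from team size $k\in[1,\infty)$ is $$L(k)=\frac1{4k}\Big(n\mu^*+\sum_{i=n+1}^\infty\lambda_i\Big)+\frac{f(k)}2\sum_{i=1}^\infty\lambda_i .$$ An optimal team size minimizes $L$ over $[1,\infty)$; it is interior if it is $>1$. For the path $C_t$, the eigenvalues are $\lambda_i(t)$ and $k^*(t)$ is the corresponding optimal team size; $\rho$ and $f$ are held fixed. *)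

(* Defs.v *)
From HB Require Import structures.
From mathcomp Require Import all_boot all_order all_algebra finmap.
From mathcomp Require Import all_classical all_reals all_analysis.
Set Implicit Arguments.
Unset Strict Implicit.
Unset Printing Implicit Defensive.
Import Order.TTheory GRing.Theory Num.Theory.
Import numFieldNormedType.Exports.
Local Open Scope classical_set_scope.
Local Open Scope ring_scope.

(* Sequences are indexed from 0: [lam i] is the eigenvalue usually written
   lambda_{i+1}. *)

Section Calculus.
Context {R : realType}.

(* Derivative relative to [D]: one-sided at an endpoint of an interval, and
   independent of the values of [g] outside [D]. *)
Definition has_derivative_within (D : set R) (g : R -> R) (t l : R) : Prop :=
  (g s - g t) / (s - t) @[s --> within D t^'] --> l.

Definition smooth_on (D : set R) (g : R -> R) : Prop :=
  exists G : nat -> R -> R,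
    (forall x, D x -> G 0%N x = g x) /\
    (forall m x, D x -> has_derivative_within D (G m) x (G m.+1 x)).

Definition l1norm (a : nat -> R) : \bar R := (\sum_(i <oo) `|a i|%:E)%E.

Definition in_l1 (a : nat -> R) : Prop := (l1norm a < +oo)%E.

(* [Lam] maps [D] into l^1 and is continuously differentiable there for the
   norm of l^1, with derivative [dLam]. *)
Definition C1_into_l1 (D : set R) (Lam dLam : R -> nat -> R) : Prop :=
  [/\ forall t, D t -> in_l1 (Lam t),
      forall t, D t -> in_l1 (dLam t),
      forall t, D t ->
        l1norm (fun i => (Lam s i - Lam t i) / (s - t) - dLam t i)
          @[s --> within D t^'] --> 0%E &
      forall t, D t ->
        l1norm (fun i => dLam s i - dLam t i) @[s --> within D (nbhs t)]
          --> 0%E].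

End Calculus.

Section Kernels.
Context {R : realType}.

Definition I01 : set R := `[0, 1]%classic.

Definition square_integrable (g : R -> R) : Prop :=
  measurable_fun I01 g /\
  (\int[lebesgue_measure]_(x in I01) ((g x) ^+ 2)%:E < +oo)%E.

Definition inner (g h : R -> R) : R :=
  \int[lebesgue_measure]_(x in I01) (g x * h x).

(* Orthonormal basis of the Hilbert space L^2([0, 1]). *)
Definition orthonormal_basis (phi : nat -> R -> R) : Prop :=
  [/\ forall i, square_integrable (phi i),
      forall i j, inner (phi i) (phi j) = (i == j)%:R &
      forall g, square_integrable g ->
        (fun m => \int[lebesgue_measure]_(x in I01)
           (g x - \sum_(i < m) inner g (phi i) * phi i x) ^+ 2)
          @ \oo --> (0 : R)].

(* Positive definiteness is meant in the sense used for covariance kernels and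
   in Mercer's theorem, i.e. with a non-strict inequality; the strict version
   would exclude kernels such as that of Brownian motion. *)
Definition feasible_kernel (C : R -> R -> R) : Prop :=
  [/\ forall x y, I01 x -> I01 y -> C x y = C y x,
      {within I01 `*` I01, continuous (fun p : R * R => C p.1 p.2)},
      forall (m : nat) (x a : 'I_m -> R), (forall p, I01 (x p)) ->
        0 <= \sum_(p < m) \sum_(q < m) a p * a q * C (x p) (x q) &
      (\int[lebesgue_measure]_(x in I01) (C x x)%:E < +oo)%E].

(* Pointwise expansion of [C] on the unit square. When [phi] is an orthonormal
   basis and [C] is feasible, it makes [lam] the sequence of eigenvalues of the
   covariance operator of [C], with eigenfunctions [phi]. *)
Definition kernel_expansion (C : R -> R -> R) (lam : nat -> R)
    (phi : nat -> R -> R) : Prop :=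
  forall x y, I01 x -> I01 y ->
    (fun m => \sum_(i < m) lam i * phi i x * phi i y) @ \oo --> C x y.

End Kernels.

Section TeamDesign.
Context {R : realType}.

(* Sum of the terms of index at least [n] of a convergent series. *)
Definition series_from (n : nat) (a : nat -> R) : R :=
  limn (fun m => \sum_(n <= i < m) a i).

(* The defining equation of mu^*. The sum is taken in the extended reals; a
   null eigenvalue contributes 0, since [ln 0 = 0] in the library. *)
Definition is_threshold (lam : nat -> R) (rho mu : R) : Prop :=
  0 < mu /\
  (2^-1%:E * \sum_(i <oo) (Num.max 0 (ln (lam i / mu)))%:E = rho%:E)%E.

(* mu^*; the default value 0 is used only if there is no solution. *)
Definition threshold (lam : nat -> R) (rho : R) : R :=
  xget 0 [set mu | is_threshold lam rho mu].

Definition active_count (lam : nat -> R) (rho : R) : nat :=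
  #|` fset_set [set i : nat | threshold lam rho < lam i]|.

Definition loss (lam : nat -> R) (f : R -> R) (rho k : R) : R :=
  let n := active_count lam rho in
  (n%:R * threshold lam rho + series_from n lam) / (4 * k)
  + f k / 2 * series_from 0 lam.

Definition optimal_team_size (lam : nat -> R) (f : R -> R) (rho k : R) : Prop :=
  1 <= k /\ forall k', 1 <= k' -> loss lam f rho k <= loss lam f rho k'.

Definition unique_interior_optimum (lam : nat -> R) (f : R -> R) (rho k : R)
    : Prop :=
  [/\ optimal_team_size lam f rho k,
      1 < k &
      forall k', optimal_team_size lam f rho k' -> k' = k].

Definition feasible_cost (f : R -> R) : Prop :=
  [/\ forall x y, 1 <= x -> x < y -> f x < f y,
      smooth_on `[1, +oo[%classic f,
      f 1 = 1 &
      f k @[k --> +oo] --> +oo].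

End TeamDesign.

(* Main.v *)
Require Import Defs.
From HB Require Import structures.
From mathcomp Require Import all_boot all_order all_algebra finmap.
From mathcomp Require Import all_classical all_reals all_analysis.
From mathcomp Require Import ring lra.
Set Implicit Arguments.
Unset Strict Implicit.
Unset Printing Implicit Defensive.
Import Order.TTheory GRing.Theory Num.Theory.
Import numFieldNormedType.Exports.
Local Open Scope classical_set_scope.
Local Open Scope ring_scope.

(** The residual loss [A] of a spectrum is the value of a reverse water-filling
    problem.  By duality, with [theta] the threshold at time [0], it is bounded
    below at every time [t] by
    [\sum_i (min (lam_i t) theta + theta * max 0 (ln (lam_i t / theta)))
       - 2 * rho * theta],
    with equality at [t = 0].  The summand is concave in [lam_i], with slope
    [w_i = theta / max (lam_i t) theta], hence
    [A t - A 0 >= \sum_i w_i * (lam_i t - lam_i 0)], where [w] is nondecreasing in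
    [i].  The total variance being constant, a constant may be subtracted from
    [w]; choosing it to be the weight at the index where the derivatives change
    sign makes all first-order terms nonnegative, and one of them is positive.
    So [A t > A 0] for small [t > 0], although neither the threshold nor [A] has
    been differentiated, and a larger [A] makes a larger team optimal since it
    enters the loss as [A / (4 k)]. *)

(** * Scalar inequalities for reverse water-filling *)

Lemma ln_sub_le (R : realType) (a b : R) : 0 < a -> 0 < b ->
  ln a - ln b <= a / b - 1.
Proof.
move=> a0 b0; rewrite -ln_div ?posrE//.
have ab0 : 0 < a / b by exact: divr_gt0.
have /le_ln1Dx : -1 < a / b - 1 by lra.
by rewrite addrC subrK.
Qed.

Lemma max0_ln_div (R : realType) (x y : R) : 0 < x -> 0 < y ->
  Num.max 0 (ln (x / y)) = if x <= y then 0 else ln x - ln y.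
Proof.
move=> x0 y0; case: ifPn => [xy|].
  by rewrite max_l// ln_le0// ler_pdivrMr// mul1r.
rewrite -ltNge => yx.
by rewrite ln_div ?posrE// max_r// subr_ge0 ler_ln ?posrE// ltW.
Qed.

(** With [th] as multiplier, the right side is minimized over [mu] at [mu = th]: its slope in [mu]
    is [1 - th / mu] below [x], and it is constant equal to [x] above. *)
Lemma waterfill_duality (R : realType) (x mu th : R) :
  0 <= x -> 0 < mu -> 0 < th ->
  Num.min x th + th * Num.max 0 (ln (x / th)) <=
  Num.min x mu + th * Num.max 0 (ln (x / mu)).
Proof.
move=> x0 mu0 th0; have [->|xneq0] := eqVneq x 0.
  by rewrite !mul0r ln0// maxxx !mulr0 !min_l ?lexx// ltW.
have {xneq0}x0 : 0 < x by rewrite lt0r xneq0.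
rewrite !max0_ln_div// !minEle.
case: (leP x th) => xth; case: (leP x mu) => xmu; rewrite ?mulr0 ?addr0//.
- have := @ln_sub_le _ mu x mu0 x0.
  have : mu / x <= 1 by rewrite ler_pdivrMr// mul1r ltW.
  have : mu / x * x = mu by rewrite divfK// gt_eqF.
  move: (mu / x) => d dx d1; rewrite -(ler_pM2l th0).
  have : 0 <= (th - x) * (1 - d) by rewrite mulr_ge0// subr_ge0.
  lra.
- have := @ln_sub_le _ x th x0 th0.
  have : x / th * th = x by rewrite divfK// gt_eqF.
  move: (x / th) => d dx; rewrite -(ler_pM2l th0); lra.
- have := @ln_sub_le _ mu th mu0 th0.
  have : mu / th * th = mu by rewrite divfK// gt_eqF.
  move: (mu / th) => d dx; rewrite -(ler_pM2l th0); lra.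
Qed.

(* Supergradient inequality at [x] for the concave function
   [y |-> min y th + th * max 0 (ln (y / th))], whose slope at [x] is
   [min 1 (th / x)], written so as to be correct at [x = 0]. *)
Lemma waterfill_concave (R : realType) (x y th : R) :
  0 <= x -> 0 <= y -> 0 < th ->
  th / Num.max x th * (x - y) <=
  (Num.min x th + th * Num.max 0 (ln (x / th)))
  - (Num.min y th + th * Num.max 0 (ln (y / th))).
Proof.
move=> x0 y0 th0.
(* Duality with [mu] equal to [Num.max y th], where the right side collapses to [y]. *)
have hy : Num.min y th + th * Num.max 0 (ln (y / th)) <= y.
  have M0 : 0 < Num.max y th by rewrite lt_max th0 orbT.
  apply: (le_trans (@waterfill_duality _ y _ th y0 M0 th0)).
  rewrite min_l ?le_max ?lexx// max_l ?mulr0 ?addr0//.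
  by rewrite ln_le0// ler_pdivrMr// mul1r le_max lexx.
have [xth|thx] := leP x th.
  rewrite divff ?gt_eqF// mul1r (@max_l _ _ 0).
    by rewrite mulr0 addr0 lerB.
  by rewrite ln_le0// ler_pdivrMr// mul1r.
have {}x0 : 0 < x by exact: lt_trans thx.
rewrite (max0_ln_div x0 th0) (lt_geF thx).
move: hy; have [yth|thy] := leP y th => hy.
  have -> : Num.max 0 (ln (y / th)) = 0.
    by rewrite max_l// ln_le0// ler_pdivrMr// mul1r.
  have := @ln_sub_le _ th x th0 x0.
  have : th / x <= 1 by rewrite ler_pdivrMr// mul1r ltW.
  have : th / x * x = th by rewrite divfK// gt_eqF.
  move: (th / x) => d dx d1; rewrite -(ler_pM2l th0).
  have : 0 <= (th - y) * (1 - d) by rewrite mulr_ge0// subr_ge0.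
  lra.
have {}y0 : 0 < y by exact: lt_trans thy.
rewrite (max0_ln_div y0 th0) (lt_geF thy).
rewrite -[th / x * _]mulrA.
have -> : x^-1 * (x - y) = 1 - y / x by field; rewrite gt_eqF.
have := @ln_sub_le _ y x y0 x0; rewrite -(ler_pM2l th0); lra.
Qed.

(** * Comparison of optimal team sizes *)

(** Revealed preference: adding the two optimality inequalities cancels the coordination terms and
    leaves [(A' - A) * (k'^-1 - k^-1) <= 0], where [A] and [A'] are the residual losses. *)
Lemma optimal_team_size_ler (R : realType) (lam lam' : nat -> R) (f : R -> R)
    (rho k k' : R) :
  series_from 0 lam = series_from 0 lam' ->
  (active_count lam rho)%:R * threshold lam rho
    + series_from (active_count lam rho) lam <
  (active_count lam' rho)%:R * threshold lam' rho
    + series_from (active_count lam' rho) lam' ->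
  optimal_team_size lam f rho k -> optimal_team_size lam' f rho k' -> k <= k'.
Proof.
move=> eqS; rewrite /optimal_team_size /loss eqS.
set A := (X in X < _); set A' := (X in _ < X); set S := series_from 0 _.
move=> AA' [k1]; rewrite -/A => hk [k1']; rewrite -/A' => hk'; rewrite leNgt; apply/negP => k'k.
have := hk _ k1'; have := hk' _ k1; rewrite !invfM !(mulrA _ _ (_^-1)).
have : k^-1 < k'^-1 by rewrite ltf_pV2 ?posrE//; lra.
move: (f k / 2 * S) (f k' / 2 * S) (k^-1) (k'^-1) => u v p q pq.
have : 0 < (A' - A) * (q - p) by rewrite mulr_gt0// subr_gt0.
lra.
Qed.

(** * Summable sequences *)

Lemma in_l1_partial_le (R : realType) (a : nat -> R) m : in_l1 a ->
  \sum_(0 <= i < m) `|a i| <= fine (l1norm a).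
Proof.
move=> a1; rewrite -lee_fin fineK; last first.
  by rewrite ge0_fin_numE//; apply: nneseries_ge0 => i _ _; rewrite lee_fin.
rewrite -sumEFin; apply: nneseries_lim_ge => i _ _; by rewrite lee_fin.
Qed.

Lemma in_l1_term_le (R : realType) (a : nat -> R) i : in_l1 a ->
  `|a i| <= fine (l1norm a).
Proof.
move=> a1; apply: le_trans (in_l1_partial_le i.+1 a1).
by rewrite big_nat_recr//= lerDr sumr_ge0.
Qed.

Lemma in_l1_cvg_series (R : realType) (a : nat -> R) :
  (forall i, 0 <= a i) -> in_l1 a -> cvgn (series a).
Proof.
move=> a0 a1; apply: nondecreasing_is_cvgn.
  by apply: nondecreasing_series => i _ _; exact: a0.
exists (fine (l1norm a)) => _ [m _ <-].
apply: le_trans (in_l1_partial_le m a1).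
by rewrite ler_sum// => i _; exact: ler_norm.
Qed.

Lemma in_l1_eventually_le (R : realType) (a : nat -> R) (e : R) :
  in_l1 a -> (forall i, 0 <= a i) -> 0 < e ->
  exists N, forall i, (N <= i)%N -> a i <= e.
Proof.
move=> a1 a0 e0; have /cvg_series_cvg_0 /cvgr_le/(_ e e0) := in_l1_cvg_series a0 a1.
by move=> [N _ hN]; exists N => i Ni; exact: hN.
Qed.

Lemma nneseries_finite_support (R : realType) (u : nat -> R) N :
  (forall i, (N <= i)%N -> u i = 0) ->
  (\sum_(i <oo) (u i)%:E = (\sum_(0 <= i < N) u i)%:E)%E.
Proof.
move=> u0; apply: lim_near_cst => //; near=> m.
rewrite sumEFin (big_cat_nat (n := N))//=; last by near: m; exact: nbhs_infty_ge.
rewrite [X in _ + X]big_nat_cond [X in _ + X]big1 ?addr0// => i /andP[/andP[Ni _] _].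
exact: u0.
Unshelve. all: by end_near. Qed.

(** * The threshold of a fixed spectrum and its residual loss *)

Section Threshold.
Context {R : realType}.
Variables (lam : nat -> R) (rho : R).
Hypotheses (lam1 : in_l1 lam) (lam0 : forall i, 0 <= lam i).
Hypotheses (lam_neq0 : exists i, lam i != 0) (rho0 : 0 < rho).

Lemma threshold_exists : exists mu, is_threshold lam rho mu.
Proof.
have [i0 /negPf li0] := lam_neq0.
have {}li0 : 0 < lam i0 by rewrite lt0r li0/= lam0.
(* At the level [a], mode [i0] alone already contributes [2 * rho]; at the level [M] below, no mode
   contributes. The threshold lies in between. *)
pose a := lam i0 * expR (- (2 * rho)).
have a0 : 0 < a by rewrite mulr_gt0 ?expR_gt0.
have lna : ln a = ln (lam i0) - 2 * rho.
  by rewrite lnM ?posrE ?expR_gt0// expRK.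
have ai0 : a < lam i0.
  by rewrite -ltr_ln ?posrE// lna ltrBlDr ltrDl mulr_gt0.
have [N hN] := in_l1_eventually_le lam1 lam0 a0.
have i0N : (i0 < N)%N.
  by rewrite ltnNge; apply/negP => /hN; rewrite leNgt ai0.
pose M := fine (l1norm lam).
have lM i : lam i <= M by rewrite -[lam i]ger0_norm//; exact: in_l1_term_le.
have M0 : 0 < M by exact: lt_le_trans (lM i0).
(* Here [s] stands for the logarithm of the level. The guard discards null eigenvalues, for which
   [ln 0 = 0] would give a spurious term. *)
pose g i (s : R) : R := if a < lam i then Num.max 0 (ln (lam i) - s) else 0.
pose F s := \sum_(0 <= i < N) g i s.
have Fc : continuous F.
  move=> s; apply: cvg_big => [|i _]; first exact: add_continuous.
  rewrite /g; case: ifP => _; last exact: cvg_cst.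
  apply: (@continuous_max _ _ (fun=> 0) (fun s => ln (lam i) - s)).
    exact: cvg_cst.
  by apply: cvgB; [exact: cvg_cst|exact: cvg_id].
have FM : F (ln M) = 0.
  rewrite /F big1// => i _; rewrite /g; case: ifP => // ai.
  by rewrite max_l// subr_le0 ler_ln ?posrE//; exact: lt_trans ai.
have Fa : 2 * rho <= F (ln a).
  rewrite /F (bigD1_seq i0)/= ?iota_uniq ?mem_index_iota//.
  have -> : g i0 (ln a) = 2 * rho.
    by rewrite /g ai0 lna opprB addrC subrK max_r// mulr_ge0 ?ltW.
  rewrite lerDl sumr_ge0// => i _; rewrite /g; case: ifP => // _.
  by rewrite le_max lexx.
have aM : ln a <= ln M by rewrite ler_ln ?posrE// (le_trans (ltW ai0)).
have rho20 : 0 <= 2 * rho by rewrite mulr_ge0 ?ltW.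
have [||c cin Fc2] := @IVT R F (ln a) (ln M) (2 * rho) aM.
- exact: continuous_subspaceT.
- by rewrite FM ge_min rho20 orbT le_max Fa.
exists (expR c); split; first exact: expR_gt0.
have ac : a <= expR c.
  by rewrite -ler_ln ?posrE ?expR_gt0// expRK; move: cin; rewrite in_itv/= => /andP[].
have small i : lam i <= a -> Num.max 0 (ln (lam i / expR c)) = 0.
  move=> la; rewrite max_l// ln_le0// ler_pdivrMr ?expR_gt0// mul1r.
  exact: le_trans ac.
rewrite (@nneseries_finite_support _ _ N); last by move=> i /hN /small.
rewrite -EFinM; congr (_%:E); apply: (mulfI (x := 2)) => //.
rewrite mulrA divff// mul1r -Fc2; apply: eq_bigr => i _.
rewrite /g; case: ltP => [ai|/small//].
by rewrite ln_div ?posrE ?expR_gt0 ?expRK//; exact: lt_trans ai.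
Qed.

Lemma thresholdP : is_threshold lam rho (threshold lam rho).
Proof. exact: xgetPex threshold_exists. Qed.

Lemma threshold_gt0 : 0 < threshold lam rho.
Proof. by have [] := thresholdP. Qed.

(** Terms vanish once the spectrum is below the threshold, so the capacity constraint holds exactly
    on long partial sums. *)
Lemma sum_log_threshold : \forall m \near \oo,
  \sum_(0 <= i < m) Num.max 0 (ln (lam i / threshold lam rho)) = 2 * rho.
Proof.
have [mu0 e] := thresholdP; set mu := threshold _ _ in mu0 e *.
have [N hN] := in_l1_eventually_le lam1 lam0 mu0.
exists N => // m Nm; move: e; rewrite (@nneseries_finite_support _ _ m).
  by rewrite -EFinM => -[<-]; rewrite mulrA divff// mul1r.
move=> i mi; rewrite max_l// ln_le0// ler_pdivrMr// mul1r hN//.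
exact: leq_trans mi.
Qed.

Hypothesis lam_dec : forall i j, (i <= j)%N -> lam j <= lam i.

Lemma threshold_lt_head : threshold lam rho < lam 0.
Proof.
rewrite ltNge; apply/negP => h; have [N _ /(_ N (leqnn N))] := sum_log_threshold.
rewrite big1; first by move: rho0; lra.
move=> i _; rewrite max_l// ln_le0// ler_pdivrMr ?threshold_gt0// mul1r.
exact: le_trans (lam_dec (leq0n i)) h.
Qed.

(* The residual loss is the sum of the posterior variances
   [min (lam i) mu^*] of reverse water-filling. *)
Lemma cvg_residual_loss :
  \sum_(0 <= i < m) Num.min (lam i) (threshold lam rho) @[m --> \oo] -->
  (active_count lam rho)%:R * threshold lam rho
  + series_from (active_count lam rho) lam.
Proof.
have mu0 := threshold_gt0.
have ex : exists N, lam N <= threshold lam rho.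
  by have [N hN] := in_l1_eventually_le lam1 lam0 mu0; exists N; exact: hN.
(* By monotonicity the active modes form an initial segment, ending at the first eigenvalue not
   above the threshold. *)
have -> : active_count lam rho = ex_minn ex.
  apply: card_fset_set; case: ex_minnP => n hn hmin.
  suff -> : [set i | threshold lam rho < lam i] = `I_n by exact: card_eqxx.
  apply/seteqP; split=> i /= hi.
    rewrite ltnNge; apply/negP => /lam_dec ni.
    by move: hi; rewrite ltNge (le_trans ni hn).
  by rewrite ltNge; apply/negP => /hmin; rewrite leqNgt hi.
case: ex_minnP => n hn hmin.
have c : cvgn (fun m => \sum_(n <= i < m) lam i).
  by rewrite is_cvg_series_restrict; exact: in_l1_cvg_series.
have H : (n%:R * threshold lam rho + \sum_(n <= i < m) lam i) @[m --> \oo]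
    --> n%:R * threshold lam rho + series_from n lam.
  by apply: cvgD; [exact: cvg_cst|exact: c].
apply: cvg_trans H; apply: near_eq_cvg; near=> m.
rewrite [RHS](big_cat_nat (n := n))//=; last by near: m; exact: nbhs_infty_ge.
congr +%R.
  rewrite big_nat_cond (eq_bigr (fun=> threshold lam rho)).
    by rewrite -big_nat_cond sumr_const_nat subn0 mulr_natl.
  move=> i /andP[/andP[_ ni] _]; rewrite min_r// leNgt; apply/negP => /ltW.
  by move=> /hmin; rewrite leqNgt ni.
rewrite big_nat_cond [RHS]big_nat_cond; apply: eq_bigr => i /andP[/andP[ni _] _].
by rewrite min_l// (le_trans _ hn)// lam_dec.
Unshelve. all: by end_near. Qed.

End Threshold.

(** * Lower bound on the change of the residual loss *)

Lemma waterfill_slope_itv (R : realType) (x th : R) : 0 < th ->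
  0 <= th / Num.max x th <= 1.
Proof.
move=> th0; have M0 : 0 < Num.max x th by rewrite lt_max th0 orbT.
by rewrite ltW ?divr_gt0//= ler_pdivrMr// mul1r le_max lexx orbT.
Qed.

Lemma waterfill_slope_le (R : realType) (x y th : R) : 0 < th -> x <= y ->
  th / Num.max y th <= th / Num.max x th.
Proof.
move=> th0 xy; rewrite ler_pM2l// lef_pV2 ?posrE ?lt_max ?th0 ?orbT//.
by rewrite ge_max !le_max xy lexx orbT.
Qed.

(** All first-order terms are nonnegative after centering the weights at [w j], so only that of [i0]
    is kept. Centered weights are at most 1 in absolute value, so the remainder costs at most its
    norm. *)
Lemma residual_loss_increment (R : realType) (lam lam' d : nat -> R)
    (rho s : R) (j i0 : nat) :
  let th := threshold lam rho in
  let w i := th / Num.max (lam' i) th in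
  let r i := (lam' i - lam i) / s - d i in
  in_l1 lam -> (forall i, 0 <= lam i) -> (exists i, lam i != 0) ->
  (forall i j, (i <= j)%N -> lam j <= lam i) ->
  in_l1 lam' -> (forall i, 0 <= lam' i) -> (exists i, lam' i != 0) ->
  (forall i j, (i <= j)%N -> lam' j <= lam' i) ->
  series_from 0 lam' = series_from 0 lam ->
  0 < rho -> 0 < s -> in_l1 r ->
  (forall i, (i <= j)%N -> d i <= 0) -> (forall i, (j < i)%N -> 0 <= d i) ->
  s * ((w i0 - w j) * d i0 - fine (l1norm r)) <=
  ((active_count lam' rho)%:R * threshold lam' rho
    + series_from (active_count lam' rho) lam')
  - ((active_count lam rho)%:R * threshold lam rho
    + series_from (active_count lam rho) lam).
Proof.
move=> th w r l1 l0 ln0 ldec l1' l0' ln0' ldec' eqS rho0 s0 r1 dle dge.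
have th0 : 0 < th by exact: threshold_gt0.
have mu0 : 0 < threshold lam' rho by exact: threshold_gt0.
have e_ge0 i : 0 <= (w i - w j) * d i.
  have [ij|ji] := leqP i j.
    rewrite mulr_le0 ?dle// subr_le0 waterfill_slope_le//; exact: ldec'.
  rewrite mulr_ge0 ?dge// subr_ge0 waterfill_slope_le//.
  exact: ldec' (ltnW ji).
have c := @cvg_residual_loss _ _ _ l1 l0 ln0 rho0 ldec.
have c' := @cvg_residual_loss _ _ _ l1' l0' ln0' rho0 ldec'.
have cS : (\sum_(0 <= i < m) lam' i - \sum_(0 <= i < m) lam i) @[m --> \oo] --> (0 : R).
  have cl : \sum_(0 <= i < m) lam i @[m --> \oo] --> series_from 0 lam.
    exact: (in_l1_cvg_series l0 l1).
  have cl' : \sum_(0 <= i < m) lam' i @[m --> \oo] --> series_from 0 lam'.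
    exact: (in_l1_cvg_series l0' l1').
  by have := cvgB cl' cl; rewrite eqS subrr; apply.
set E := (w i0 - w j) * d i0 - _.
(* Centering is free only in the limit, where total variances agree; its cost on a partial sum is
   carried along explicitly. *)
have cE : (s * E + w j * (\sum_(0 <= i < m) lam' i - \sum_(0 <= i < m) lam i))
    @[m --> \oo] --> s * E.
  rewrite -[X in _ --> X]addr0 -[X in _ + X](mulr0 (w j)).
  by apply: cvgD; [exact: cvg_cst|apply: cvgM => //; exact: cvg_cst].
apply: (ler_cvg_to cE (cvgB c' c)); near=> m.
rewrite -[leRHS]/(\sum_(0 <= i < m) Num.min (lam' i) (threshold lam' rho)
  - \sum_(0 <= i < m) Num.min (lam i) th).
have slog : \sum_(0 <= i < m) Num.max 0 (ln (lam i / th)) = 2 * rho.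
  by near: m; exact: sum_log_threshold.
have slog' : \sum_(0 <= i < m) Num.max 0 (ln (lam' i / threshold lam' rho))
    = 2 * rho.
  by near: m; exact: sum_log_threshold.
have i0m : (i0 < m)%N by near: m; exact: nbhs_infty_gt.
(* Concavity at [lam'] with level [th], then duality to pass to the threshold of [lam']. After
   summation both logarithmic sums equal [2 * rho] and cancel. *)
have term i : s * ((w i - w j) * d i - `|r i|) + w j * (lam' i - lam i) <=
    (Num.min (lam' i) (threshold lam' rho)
      + th * Num.max 0 (ln (lam' i / threshold lam' rho)))
    - (Num.min (lam i) th + th * Num.max 0 (ln (lam i / th))).
  apply: (@le_trans _ _ (w i * (lam' i - lam i))).
    have -> : lam' i - lam i = s * (d i + r i).
      by rewrite /r [d i + _]addrC subrK mulrCA divff ?mulr1// gt_eqF.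
    rewrite -subr_ge0; suff : 0 <= s * (`|r i| + (w i - w j) * r i) by lra.
    have /andP[wi0 wi1] : 0 <= w i <= 1 by exact: waterfill_slope_itv.
    have /andP[wj0 wj1] : 0 <= w j <= 1 by exact: waterfill_slope_itv.
    have wr : `|(w i - w j) * r i| <= `|r i|.
      by rewrite normrM ler_piMl// ler_norml; apply/andP; split; lra.
    have := ler_norm (- ((w i - w j) * r i)); rewrite normrN => wr'.
    by rewrite mulr_ge0 ?(ltW s0)//; lra.
  apply: (le_trans (waterfill_concave (l0' i) (l0 i) th0)).
  by rewrite lerB// waterfill_duality.
have := ler_sum (index_iota 0 m) (fun i (_ : true) => term i).
rewrite big_split sumrB big_split big_split -!mulr_sumr !sumrB /=.
rewrite slog slog'.
have := in_l1_partial_le m r1.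
have : (w i0 - w j) * d i0 <= \sum_(0 <= i < m) (w i - w j) * d i.
  by rewrite (bigD1_seq i0)/= ?iota_uniq ?mem_index_iota// lerDl sumr_ge0.
rewrite /E -/th; move: (\sum_(_ <= i < _) _ * _) (\sum_(_ <= i < _) `|_|).
move: ((w i0 - w j) * d i0) (fine (l1norm r)) => x y e n xe ny.
have : 0 <= s * (e - n - (x - y)) by rewrite mulr_ge0 ?(ltW s0)//; lra.
lra.
Unshelve. all: by end_near. Qed.

(** * One-sided limits along the path at time 0 *)

Lemma proper_within_itv0 (R : realType) (eps : R) : 0 < eps ->
  ProperFilter (within `[0, eps]%classic (0 : R)^').
Proof.
move=> eps0; apply: Build_ProperFilter.
move=> [e /= e0 he]; pose x := Num.min (e / 2) eps.
have x0 : 0 < x by rewrite lt_min eps0 divr_gt0.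
apply: (he x) => /=; last 2 first.
- by rewrite gt_eqF.
- by rewrite in_itv/= ltW//= /x ge_min lexx orbT.
rewrite sub0r normrN gtr0_norm// /x gt_min; apply/orP; left; lra.
Qed.

Section Path.
Context {R : realType}.
Variables (eps : R) (Lam : R -> nat -> R) (d : nat -> R).
Let F := within `[0, eps]%classic (0 : R)^'.
Let r s i := (Lam s i - Lam 0 i) / (s - 0) - d i.

Hypothesis r_cvg : l1norm (r s) @[s --> F] --> 0%E.

Lemma near_remainder_in_l1 : \forall s \near F, in_l1 (r s).
Proof.
have /fine_cvgP[fn _] := r_cvg.
by apply: filterS fn => s; rewrite fin_numElt => /andP[].
Qed.

Lemma cvg_remainder_norm : fine (l1norm (r s)) @[s --> F] --> (0 : R).
Proof. by have /fine_cvgP[] := r_cvg. Qed.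

Lemma near_within_itv0 : \forall s \near F, 0 < s <= eps.
Proof.
have h1 : F `[0, eps]%classic by exact: withinT.
have h2 : \forall s \near F, s != 0.
  by apply: filterS (nbhs_dnbhs_neq (0 : R)) => s sn0 _.
apply: filterS2 h1 h2 => s /=; rewrite in_itv/= => /andP[s0 se] sn0.
by rewrite lt0r sn0 s0.
Qed.

Lemma cvg_eigenvalue i : Lam s i @[s --> F] --> Lam 0 i.
Proof.
have s_cvg : (s : R) @[s --> F] --> (0 : R).
  by apply: cvg_trans (@nbhs_dnbhs _ (0 : R)); exact: cvg_within.
have ri : r s i @[s --> F] --> (0 : R).
  apply/norm_cvg0P; apply: (squeeze_cvgr _ (cvg_cst 0) cvg_remainder_norm).
  by apply: filterS near_remainder_in_l1 => s h; rewrite normr_ge0 in_l1_term_le.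
(* This is [Lam s i] rewritten through its difference quotient, valid for [s != 0]. *)
have H : (Lam 0 i + s * (d i + r s i)) @[s --> F] --> Lam 0 i.
  rewrite -[X in _ --> X]addr0 -[X in _ + X](mul0r (d i + 0)).
  apply: cvgD; first exact: cvg_cst.
  by apply: cvgM => //; apply: cvgD => //; exact: cvg_cst.
apply: cvg_trans H; apply: near_eq_cvg.
apply: filterS near_within_itv0 => s /andP[s0 _].
by rewrite /r subr0 [d i + _]addrC subrK mulrCA divff ?gt_eqF// mulr1 addrC subrK.
Qed.

Lemma cvg_waterfill_slope (th : R) i : 0 < th ->
  th / Num.max (Lam s i) th @[s --> F] --> th / Num.max (Lam 0 i) th.
Proof.
move=> th0; apply: cvgM; first exact: cvg_cst.
apply: cvgV; first by rewrite gt_eqF// lt_max th0 orbT.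
apply: (@cvg_comp _ _ _ (Lam ^~ i) (fun x => Num.max x th) _ _ _ (@cvg_eigenvalue i)).
apply: (@continuous_max _ _ id (fun=> th)); first exact: cvg_id.
exact: cvg_cst.
Qed.

End Path.

Theorem mainTheorem5 (R : realType) (eps : R) (heps : 0 < eps)
  (f : R -> R) (hf : feasible_cost f)
  (phi : nat -> R -> R) (hphi : orthonormal_basis phi)
  (Lam dLam : R -> nat -> R)
  (hC1 : C1_into_l1 `[0, eps]%classic Lam dLam)
  (hge0 : forall t, 0 <= t <= eps -> forall i, 0 <= Lam t i)
  (hneq0 : forall t, 0 <= t <= eps -> exists i, Lam t i != 0)
  (hdec : forall t, 0 <= t <= eps ->
     forall i j, (i <= j)%N -> Lam t j <= Lam t i)
  (hinf : forall t, 0 <= t <= eps -> infinite_set [set i | 0 < Lam t i])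
  (C : R -> R -> R -> R)
  (hexp : forall t, 0 <= t <= eps -> kernel_expansion (C t) (Lam t) phi)
  (hfeas : forall t, 0 <= t <= eps -> feasible_kernel (C t))
  (hconst : forall t, 0 <= t <= eps ->
     series_from 0 (Lam t) = series_from 0 (Lam 0))
  (hsign : exists2 jstar : nat, (1 <= jstar)%N &
     (forall i, (i < jstar)%N -> dLam 0 i < 0) /\
     (forall i, (jstar <= i)%N -> 0 < dLam 0 i))
  (rho : R) (hrho : 0 < rho)
  (kstar : R -> R)
  (hkstar : forall t, 0 <= t <= eps ->
     unique_interior_optimum (Lam t) f rho (kstar t)) :
  forall l : R, has_derivative_within `[0, eps]%classic kstar 0 l -> 0 <= l.
Proof.
(* Writing [jstar] as [j.+1] makes [j] the last index with a negative derivative, since indices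
   start at 0. *)
have [hl1 _ hd _] := hC1; have [[//|j] _ [dneg dpos]] := hsign.
have D0 : 0 <= (0 : R) <= eps by rewrite lexx ltW.
have D t : 0 <= t <= eps -> `[0, eps]%classic t by rewrite /= in_itv.
have r_cvg := hd 0 (D _ D0).
have FF := proper_within_itv0 heps.
set th := threshold (Lam 0) rho.
have th0 : 0 < th by apply: threshold_gt0 => //; [exact: hl1 (D _ D0)|exact: hge0|exact: hneq0].
have thlt : th < Lam 0 0%N.
  apply: threshold_lt_head => //; [exact: hl1 (D _ D0)|exact: hge0|exact: hneq0|exact: hdec].
pose w s i := th / Num.max (Lam s i) th.
(* A mode whose contribution is strict: the top one if mode [j] is below the
   threshold, and a mode below the threshold otherwise. *)
have [i0 hi0] : exists i0, 0 < (w 0 i0 - w 0 j) * dLam 0 i0.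
  have [jth|thj] := leP (Lam 0 j) th.
    exists 0%N; rewrite nmulr_lgt0 ?dneg//.
    rewrite subr_lt0 /w (max_l (ltW thlt)) (max_r jth) divff ?gt_eqF//.
    by rewrite ltr_pdivrMr ?mul1r// (lt_trans th0).
  have [N hN] := in_l1_eventually_le (hl1 _ (D _ D0)) (hge0 _ D0) th0.
  have jN : (j < N)%N by rewrite ltnNge; apply/negP => /hN; rewrite leNgt thj.
  exists N; rewrite mulr_gt0 ?dpos// subr_gt0 /w (max_r (hN N (leqnn N))).
  rewrite (max_l (ltW thj)) divff ?gt_eqF//.
  by rewrite ltr_pdivrMr ?mul1r// (lt_trans th0).
(* The lower bound on the increment divided by [s]: its weights are taken at time [s], and its
   positive limit makes it positive for small [s]. *)
have gain_cvg : ((w s i0 - w s j) * dLam 0 i0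
      - fine (l1norm (fun i => (Lam s i - Lam 0 i) / (s - 0) - dLam 0 i)))
    @[s --> within `[0, eps]%classic 0^'] --> (w 0 i0 - w 0 j) * dLam 0 i0.
  rewrite -[X in _ --> X]subr0; apply: cvgB; last exact: cvg_remainder_norm r_cvg.
  apply: cvgM; last exact: cvg_cst.
  by apply: cvgB; exact: cvg_waterfill_slope r_cvg _ _ th0.
have kstar_ge : \forall s \near within `[0, eps]%classic 0^', kstar 0 <= kstar s.
  have gain_gt0 := cvgr_gt _ gain_cvg _ hi0.
  have pos := near_within_itv0 eps; have l1 := near_remainder_in_l1 r_cvg.
  apply: filterS3 (gain_gt0 _) pos l1 => s gain /andP[s0 se] rs1.
  have Ds : 0 <= s <= eps by rewrite ltW.
  have [opt0 _ _] := hkstar _ D0; have [opts _ _] := hkstar _ Ds.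
  apply: (optimal_team_size_ler _ _ opt0 opts); first by rewrite hconst.
  have := residual_loss_increment (d := dLam 0) (j := j) i0
    (hl1 _ (D _ D0)) (hge0 _ D0) (hneq0 _ D0) (hdec _ D0)
    (hl1 _ (D _ Ds)) (hge0 _ Ds) (hneq0 _ Ds) (hdec _ Ds) (hconst _ Ds) hrho s0.
  move: gain rs1; rewrite subr0 => gain rs1 inc.
  rewrite -subr_gt0; apply: lt_le_trans (inc rs1 _ _) => [|i ij|i ij].
  - by rewrite mulr_gt0.
  - by rewrite ltW// dneg.
  - by rewrite ltW// dpos.
(* The difference quotients of [kstar] are eventually nonnegative, hence so is their limit. *)
move=> l hl; apply: (cvgr_to_ge hl); have pos := near_within_itv0 eps.
apply: filterS2 kstar_ge pos => s ks /andP[s0 _].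
by rewrite subr0 divr_ge0 ?subr_ge0// ltW.
Qed.
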